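(* Let $n,m$ be positive integers with $(3/2)^m\le 2^n-1<(3/2)^{m+1}$, let $G_n$ be the bipartite graph defined in the context, with edge set $E$, let $\varOmega=2^E$, and let $\pi_\varOmega$ be the probability distribution on $\varOmega$ defined in the context. Suppose $d\le m/12$. Then any ergodic Markov chain on state space $\varOmega$ with stationary distribution $\pi_\varOmega$ that is $d$-cautious has mixing time $\Omega(\exp(m/576))$. That is, there exist absolute constants $c>0$ and $n_0$ such that for all pairs $(n,m)$ of positive integers satisfying $(3/2)^m\le 2^n-1<(3/2)^{m+1}$ with $n\ge n_0$, all $d\le m/12$, and every ergodic $d$-cautious Markov chain on $\varOmega$ with stationary distribution $\pi_\varOmega$, the mixing time $\tau$ of the chain satisfies $\tau\ge c\exp(m/576)$. In particular, the Ge-Štefankovič (GS) Process on $G_n$, which is an ergodic $1$-cautious Markov chain on $\varOmega$ with stationary distribution $\pi_\varOmega$, has mixing time exponential in the number of vertices $n+2m$ of $G_n$: there exist absolute constants $c'>0$ and $n_1$ such that for all pairs $(n,m)$ of positive integers satisfying $(3/2)^m\le 2^n-1<(3/2)^{m+1}$ with $n\ge n_1$ its mixing time is at least $\exp(c'(n+2m))$.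
   Context: **The graph $G_n$.** Let $n,m$ be positive integers such that $(3/2)^m\le 2^n-1<(3/2)^{m+1}$ (so $m$ is determined by $n$). The graph $G_n=(U'\cup V\cup U'',E)$ has vertex set the disjoint union of $U',V,U''$ with $|U'|=n$ and $|V|=|U''|=m$. Its edge set is $E=(U'\times V)\cup M$, where $M$ is a perfect matching between the vertices of $V$ and those of $U''$. Thus $G_n$ is bipartite with bipartition $(U,V)$, where $U=U'\cup U''$; the edges between $U'$ and $V$ form a complete bipartite graph and the edges between $V$ and $U''$ form a perfect matching. **The distribution $\pi_\varOmega$.** For a bipartite graph $G=(U\cup V,E)$ with bipartition $(U,V)$, let $\varOmega=2^E$ (the set of all subsets of $E$) and $\varSigma=2^U$ (the set of all subsets of $U$). For $(I,A)\in\varSigma\times\varOmega$, say that the consistency relation $\chi(I,A)$ holds if and only if every vertex of $V$ has even degree in the subgraph of $(U\cup V,A)$ induced by the vertex set $I\cup V$. Consider the uniform distribution on the set of consistent pairs $\{(I,A)\in\varSigma\times\varOmega\mid\chi(I,A)\}$. Then $\pi_\varOmega$ is the induced marginal distribution on $\varOmega$, i.e. $\pi_\varOmega(A)=|\{I\in\varSigma:\chi(I,A)\}|\,/\,|\{(I,A')\in\varSigma\times\varOmega:\chi(I,A')\}|$. **$d$-cautious chains.** A Markov chain on $\varOmega$ with transition probabilities $P:\varOmega^2\to[0,1]$ is $d$-cautious if for all $A,A'\in\varOmega$, $P(A,A')>0$ implies $|A\oplus A'|\le d$, where $\oplus$ denotes symmetric difference. **Mixing time.** Let $(X_t)$ be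 an ergodic (discrete-time) Markov chain on a finite state space $\varOmega$ with unique stationary distribution $\pi$. For $x_0\in\varOmega$, let $p_t$ be the distribution of the chain at time $t$ when started at $x_0$ at time $0$. The mixing time $\tau(x_0)$ with initial state $x_0$ is the first time $t$ at which $\frac12\|p_t-\pi\|_1\le e^{-1}$. The mixing time is $\tau=\max_{x_0\in\varOmega}\tau(x_0)$. **GS Process.** The Ge-Štefankovič Process is an ergodic ''single bond flip'' Markov chain on state space $\varOmega$ with stationary distribution $\pi_\varOmega$; each transition changes at most one edge, so it is $1$-cautious. Only these properties of the GS Process (ergodic, $1$-cautious, stationary distribution $\pi_\varOmega$) are relevant: the ''in particular'' assertion may be read as the lower bound holding for every Markov chain with these properties. *)

(* Defs.v *)
From mathcomp Require Import all_boot all_order all_algebra.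
From mathcomp Require Import boolp reals constructive_ereal ereal sequences.

Set Implicit Arguments.
Unset Strict Implicit.
Unset Printing Implicit Defensive.

Import Order.TTheory GRing.Theory Num.Theory.
Local Open Scope ring_scope.

(* Discrete-time Markov chains on a finite state space T; the chain is given
   by its transition probabilities P : T -> T -> R. *)
Section MarkovChains.
Context {R : realType} {T : finType}.
Implicit Types (P : T -> T -> R) (pi : T -> R) (x y : T) (t : nat).

Definition transition_matrix P : Prop :=
  (forall x y, 0 <= P x y) /\ (forall x, \sum_y P x y = 1).

(* [chain_dist P x t y] is the probability that the chain started at [x] is at
   [y] at time [t], that is P^t(x, y). *)
Fixpoint chain_dist P x t : T -> R :=
  if t is s.+1 then fun y => \sum_z chain_dist P x s z * P z y
  else fun y => (y == x)%:R.

Definition irreducible_chain P : Prop :=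
  forall x y, exists t, 0 < chain_dist P x t y.

(* For every state x, the gcd of the return times {t > 0 | P^t(x, x) > 0}
   is 1. *)
Definition aperiodic_chain P : Prop :=
  forall x k,
    (forall t, (0 < t)%N -> 0 < chain_dist P x t x -> (k %| t)%N) -> k = 1%N.

Definition ergodic_chain P : Prop :=
  [/\ transition_matrix P, irreducible_chain P & aperiodic_chain P].

Definition probability_dist pi : Prop :=
  (forall x, 0 <= pi x) /\ \sum_x pi x = 1.

Definition stationary_dist P pi : Prop :=
  probability_dist pi /\ (forall y, \sum_x pi x * P x y = pi y).

Definition close_at P pi x t : bool :=
  2^-1 * \sum_y `|chain_dist P x t y - pi y| <= expR (- 1).

(* The first time at which the chain is close to [pi]. The default +oo is the
   infimum of the empty set of times; it does not occur when the chain is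
   ergodic with stationary distribution [pi]. *)
Definition mixing_time_from P pi x : \bar R :=
  if pselect (exists t, close_at P pi x t) is left ex_t
  then ((ex_minn ex_t)%:R)%:E else +oo%E.

Definition mixing_time P pi : \bar R :=
  \big[maxe/-oo%E]_(x : T) mixing_time_from P pi x.

End MarkovChains.

(* A bipartite graph with bipartition (U, V) is given by its edge set
   E : {set U * V}, the pair (u, v) standing for the edge uv. *)
Section BipartiteGraphs.
Context {U V : finType}.

Definition Omega (E : {set U * V}) : finType :=
  {A : {set U * V} | A \in powerset E}.

(* The degree of v in the subgraph of (U + V, A) induced by I + V. *)
Definition induced_degree (I : {set U}) (A : {set U * V}) (v : V) : nat :=
  #|[set e in A | (e.1 \in I) && (e.2 == v)]|.

Definition consistent (I : {set U}) (A : {set U * V}) : bool :=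
  [forall v, ~~ odd (induced_degree I A v)].

Definition pi_Omega (R : realType) (E : {set U * V}) (A : Omega E) : R :=
  #|[set I : {set U} | consistent I (val A)]|%:R /
  #|[set IA : {set U} * Omega E | consistent IA.1 (val IA.2)]|%:R.

Definition edge_symdiff (A B : {set U * V}) : {set U * V} :=
  (A :\: B) :|: (B :\: A).

Definition cautious (R : realType) (E : {set U * V}) (d : nat)
    (P : Omega E -> Omega E -> R) : Prop :=
  forall A B : Omega E,
    0 < P A B -> (#|edge_symdiff (val A) (val B)| <= d)%N.

End BipartiteGraphs.

Arguments pi_Omega {U V} R E A.

(* U' = 'I_n, V = 'I_m and U'' = 'I_m, where the vertices of U'' are labelled
   so that the perfect matching pairs the vertices with the same label; the
   side U = U' + U'' of the bipartition is the sum type. *)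
Definition Gn_edges (n m : nat) : {set ('I_n + 'I_m) * 'I_m} :=
  [set e | match e.1 with inl _ => true | inr u => u == e.2 end].

Definition admissible (R : realType) (n m : nat) : Prop :=
  [/\ (0 < n)%N, (0 < m)%N &
      (3 / 2) ^+ m <= (2 ^+ n - 1 : R) < (3 / 2) ^+ m.+1].

(* Main.v *)
Require Import Defs.
From mathcomp Require Import all_boot all_order all_algebra.
From mathcomp Require Import boolp reals constructive_ereal ereal sequences exp.
From mathcomp Require Import zify ring lra.

Set Implicit Arguments.
Unset Strict Implicit.
Unset Printing Implicit Defensive.

Import Order.TTheory GRing.Theory Num.Theory.
Local Open Scope ring_scope.

(** The stationary distribution has two phases of comparable mass, separated by
    a bottleneck of exponentially small mass that a cautious chain cannot jump
    over.

    Write a subset I of U as J in U' together with a subset of U''. Given J,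
    the parity constraints at the vertices v of V are independent of each other:
    each concerns only the set C of edges of A from v to U' (a subset of U'),
    the bit s telling whether the matching edge of v is in A, and the bit i
    telling whether the partner of v is in I; it says that
    #|J :&: C| + (s && i) is even. If J is empty, then s && i must be false,
    which leaves three equally likely pairs (s, i), one of which has s = 1. If J
    is nonempty, then #|J :&: C| is even for exactly half of the sets C, three
    pairs (s, i) being possible when it is even and only s = i = 1 when it is
    odd, so that s = 1 half of the time. Hence, with D = 2 ^ n:
    - the low phase J = set0 has weight (3 * D) ^ m, and its number k of
      matching edges is binomial (m, 1/3);
    - the high phase J != set0 has weight (D - 1) * (2 * D) ^ m, and its k is
      binomial (m, 1/2).
    The hypothesis relating n and m says precisely that the weight of the high
    phase is between 1 and 3/2 times that of the low phase
    ([phases_balanced]).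

    Let W be the set of edge sets with k <= 3m/8. A step that changes at most
    m/12 edges and leaves W arrives in the window 3m/8 < k <= 11m/24, which lies
    m/24 away from both means m/3 and m/2; by Chernoff's bound its mass is at
    most exp(-m/576) ([low_phase_tail], [high_phase_tail],
    [mass_boundary_le]). A chain started from the stationary distribution
    conditioned on W can escape only through that window, so that the mass that
    has escaped after t steps is at most t times the mass of the window
    ([restricted_flow_le]). At the mixing time the escaped mass must be a
    constant, since, up to small errors, W has mass at least 2/5 and its
    complement has mass at least 1/2, which exceeds 1/e; this gives
    [Gn_mixing_time_ge]. The second assertion follows because n <= m
    ([admissible_ge]). *)

(** * The bottleneck bound for Markov chains *)

Section Bottleneck.
Context {R : realType} {T : finType}.
Context (P : T -> T -> R) (pi : T -> R).
Context (tmP : transition_matrix P).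
Context (piP : stationary_dist P pi).

Lemma chain_dist_ge0 x t y : 0 <= chain_dist P x t y.
Proof.
elim: t y => [|t IHt] y /=; first exact: ler0n.
by apply: sumr_ge0 => z _; rewrite mulr_ge0 // tmP.1.
Qed.

Lemma chain_dist_sum1 x t : \sum_y chain_dist P x t y = 1.
Proof.
elim: t => [|t IHt] /=.
  rewrite (bigD1 x) //= eqxx big1 ?addr0 // => y /negbTE yx.
  by rewrite yx.
rewrite exchange_big /= -[RHS]IHt; apply: eq_bigr => z _.
by rewrite -mulr_sumr tmP.2 mulr1.
Qed.

(** A step of the chain does not increase the distance to a stationary
    distribution. Thus at the largest of the mixing times of the individual
    starting states, all starting states are close at once. *)
Lemma close_at_le x s t : (s <= t)%N -> close_at P pi x s -> close_at P pi x t.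
Proof.
move=> /subnK <-; elim: (t - s)%N => [//|k IHk] /IHk {IHk}.
rewrite addSn; move: (k + s)%N => {}t.
rewrite /close_at; apply: le_trans.
rewrite ler_pM2l ?invr_gt0 ?ltr0n //.
under eq_bigr => y _ do rewrite /= -piP.2 -sumrB.
apply: (@le_trans _ _ (\sum_y \sum_z `|chain_dist P x t z - pi z| * P z y)).
  apply: ler_sum => y _; apply: (le_trans (ler_norm_sum _ _ _)).
  by apply: ler_sum => z _; rewrite -mulrBl normrM (ger0_norm (tmP.1 _ _)).
rewrite exchange_big /=; apply: ler_sum => z _.
by rewrite -mulr_sumr tmP.2 mulr1.
Qed.

(** Total variation bounds the discrepancy on every event: the factor 1/2 in
    [close_at] is absorbed because the differences on S and on its complement
    cancel. *)
Lemma close_at_event (S : {set T}) x t : close_at P pi x t ->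
  \sum_(y in S) pi y - expR (- 1) <= \sum_(y in S) chain_dist P x t y.
Proof.
rewrite /close_at => ct.
rewrite lerBlDr -lerBlDl -sumrB; apply: le_trans ct.
pose f y := pi y - chain_dist P x t y.
have f0 : \sum_y f y = 0 by rewrite sumrB chain_dist_sum1 piP.1.2 subrr.
rewrite -[leLHS](@mulKf _ 2) ?pnatr_eq0 // ler_pM2l ?invr_gt0 ?ltr0n //.
have fS : \sum_(y in S) f y = - \sum_(y | y \notin S) f y.
  by move/eqP: f0; rewrite (bigID (mem S)) /= addr_eq0 => /eqP.
rewrite mulr_natl mulr2n [leRHS](bigID (mem S)) /= -/(f _) {2}fS -sumrN.
apply: lerD; apply: ler_sum => y _; first by rewrite /f distrC ler_norm.
by rewrite /f opprB ler_norm.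
Qed.

(** The left-hand side is the mass outside W at time t of the chain started
    from pi restricted to W. This evolving measure mu never exceeds pi, and so
    in one step the mass that newly leaves W is at most the stationary flow into
    bd, hence at most the mass of bd. *)
Lemma restricted_flow_le (W bd : {set T}) t :
    (forall x y, x \in W -> y \notin W -> 0 < P x y -> y \in bd) ->
  \sum_(x in W) pi x * \sum_(y in ~: W) chain_dist P x t y
    <= t%:R * \sum_(y in bd) pi y.
Proof.
move=> Wbd.
pose mu s y := \sum_(x in W) pi x * chain_dist P x s y.
have piE := piP.2; have pi0 := piP.1.1.
have muS s y : mu s.+1 y = \sum_z mu s z * P z y.
  rewrite /mu /=; under [RHS]eq_bigr => z _ do rewrite mulr_suml.
  rewrite exchange_big /=; apply: eq_bigr => x _.
  by rewrite mulr_sumr; apply: eq_bigr => z _; rewrite mulrA.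
have mu_ge0 s y : 0 <= mu s y.
  by apply: sumr_ge0 => x _; rewrite mulr_ge0 // chain_dist_ge0.
have mu_le s y : mu s y <= pi y.
  elim: s y => [|s IHs] y; last first.
    by rewrite muS -piE; apply: ler_sum => z _; rewrite ler_wpM2r // tmP.1.
  rewrite /mu /= big_mkcond (bigD1 y) //= eqxx mulr1 big1 ?addr0.
    by case: ifP.
  by move=> x xy; rewrite eq_sym (negbTE xy) mulr0 if_same.
have -> : \sum_(x in W) pi x * \sum_(y in ~: W) chain_dist P x t y
    = \sum_(y in ~: W) mu t y.
  by rewrite exchange_big /=; apply: eq_bigr => x _; rewrite mulr_sumr.
elim: t => [|t IHt].
  rewrite mul0r big1 // => y; rewrite inE => yW.
  rewrite /mu big1 // => x xW /=.
  have /negbTE -> : y != x by apply: contraNneq yW => ->.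
  by rewrite mulr0.
under eq_bigr => y _ do rewrite muS.
rewrite exchange_big /= (bigID (mem W)) /= -natr1 mulrDl mul1r addrC.
apply: lerD.
  apply: le_trans IHt; under [leRHS]eq_bigl => y do rewrite inE.
  apply: ler_sum => z _; rewrite -mulr_sumr ler_piMr //.
  rewrite -(tmP.2 z) [leRHS](bigID (mem (~: W))) /= lerDl.
  by apply: sumr_ge0 => y _; rewrite tmP.1.
rewrite exchange_big /=.
under [leRHS]eq_bigr => y _ do rewrite -piE.
rewrite [leLHS]big_mkcond [leRHS]big_mkcond /=; apply: ler_sum => y _.
rewrite inE; case: ifPn => [yW|_]; last first.
  by case: ifP => // _; apply: sumr_ge0 => z _; rewrite mulr_ge0 ?tmP.1.
case: ifPn => [_|ybd].
  rewrite [leRHS](bigID (mem W)) /= -[leLHS]addr0; apply: lerD.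
    by apply: ler_sum => z _; rewrite ler_wpM2r ?tmP.1.
  by apply: sumr_ge0 => z _; rewrite mulr_ge0 ?tmP.1.
rewrite big1 // => z zW.
have := tmP.1 z y; rewrite le_eqVlt => /predU1P[<-|]; first by rewrite mulr0.
by move=> /(Wbd _ _ zW yW); rewrite (negbTE ybd).
Qed.

(** The time at which all states are close bounds the mixing time from below
    also when some [mixing_time_from] is infinite, as the maximum is then
    infinite. The type is nonempty because the maximum over no state is -oo. *)
Lemma mixing_time_ge_close (B : R) :
    (0 < #|T|)%N ->
    (forall t, (forall x, close_at P pi x t) -> B <= t%:R) ->
  (B%:E <= mixing_time P pi)%E.
Proof.
move=> T0 HB; rewrite leNgt; apply/negP => mixB.
have fromB x : (mixing_time_from P pi x < B%:E)%E.
  by apply: le_lt_trans mixB; rewrite /mixing_time (bigD1 x) //= le_max lexx.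
have /choice[t tP] : forall x, exists t : nat, t%:R < B /\ close_at P pi x t.
  move=> x; have := fromB x; rewrite /mixing_time_from.
  case: pselect => // ex_t; rewrite lte_fin.
  by case: ex_minnP => t ct _ tB; exists t.
have [x0 _] := card_gt0P T0.
pose x1 := [arg max_(i > x0) t i]%N.
have tmax x : (t x <= t x1)%N.
  by rewrite /x1; case: arg_maxnP => // i _; apply.
have := HB (t x1) (fun x => close_at_le (tmax x) (tP x).2).
by rewrite leNgt (tP x1).1.
Qed.

(** At any time when all states are close, the chain started in W must have sent
    at least pi(~: W) - 1/e outside W, for each starting state of W;
    [restricted_flow_le] bounds the total. *)
Lemma mixing_time_bottleneck (W bd : {set T}) (b : R) :
    (forall x y, x \in W -> y \notin W -> 0 < P x y -> y \in bd) ->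
    0 < b -> \sum_(y in bd) pi y <= b ->
  (((\sum_(x in W) pi x) * (\sum_(x in ~: W) pi x - expR (- 1)) / b)%:E
    <= mixing_time P pi)%E.
Proof.
move=> Wbd b0 bdb; apply: mixing_time_ge_close => [|t ct].
  rewrite lt0n; apply/eqP => /card0_eq T0.
  have := piP.1.2; rewrite big_pred0.
    by move=> /esym/eqP; rewrite oner_eq0.
  by move=> x; have := T0 x; rewrite !inE.
rewrite ler_pdivrMr //.
apply: le_trans (ler_wpM2l _ bdb); last exact: ler0n.
apply: le_trans (restricted_flow_le t Wbd).
rewrite mulr_suml; apply: ler_sum => x _; apply: ler_wpM2l; first exact: piP.1.1.
exact: close_at_event.
Qed.

End Bottleneck.

(** * The parity constraint at one vertex *)

Section LocalSums.
Context {R : realType} {n : nat}.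
Implicit Types (J A : {set 'I_n}).

Lemma sum_set_const (x : R) : \sum_(A : {set 'I_n}) x = 2 ^+ n * x.
Proof.
have card_sets : #|{set 'I_n}| = (2 ^ n)%N.
  by rewrite -[n in RHS]card_ord -[in RHS]cardsT -card_powerset powersetT cardsT.
by rewrite sumr_const card_sets -natrX mulr_natl.
Qed.

(** Adding or removing a fixed element a of J flips the parity of #|J :&: A|, so
    both parities are taken equally often. *)
Lemma sum_parity J (f : bool -> R) : J != set0 ->
  2 * \sum_(A : {set 'I_n}) f (odd #|J :&: A|) = 2 ^+ n * (f true + f false).
Proof.
case/set0Pn => a aJ.
pose toggle A := if a \in A then A :\ a else a |: A.
have toggleK : involutive toggle.
  move=> A; rewrite /toggle; case: (boolP (a \in A)) => aA.
    by rewrite setD11 setD1K.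
  by rewrite setU11 setU1K.
have odd_toggle A : odd #|J :&: toggle A| = ~~ odd #|J :&: A|.
  rewrite /toggle; case: ifPn => aA.
    by rewrite setIDA [in RHS](cardsD1 a) inE aJ aA /= negbK.
  by rewrite setIUr (setIidPr _) ?sub1set // cardsU1 inE (negbTE aA) andbF.
rewrite mulr_natl mulr2n {1}(reindex_inj (inv_inj toggleK)) -big_split /=.
rewrite -sum_set_const; apply: eq_bigr => A _; rewrite odd_toggle.
by case: odd => //=; rewrite addrC.
Qed.

(** The data (C, s, i) at a vertex v of V: the edges C from v to U', whether the
    matching edge of v is present (s), and whether the partner of v in U'' is
    selected (i). *)
Definition local_state : finType := ({set 'I_n} * bool * bool)%type.

Definition locally_even J (c : local_state) : bool :=
  ~~ odd (#|J :&: c.1.1| + (c.1.2 && c.2)).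

(** Generating function, marked by s, of the states allowed at one vertex. An
    even #|J :&: C| leaves three pairs (s, i), contributing 2 + z; an odd one
    forces s = i = 1, contributing z. The even case always occurs for J = set0;
    otherwise the two cases average to 1 + z. *)
Lemma sum_locally_even J (z : R) :
  \sum_(c | locally_even J c) z ^+ c.1.2
    = 2 ^+ n * (if J == set0 then 2 + z else 1 + z).
Proof.
rewrite big_mkcond.
rewrite -(pair_bigA _ (fun As i =>
  if locally_even J (As, i) then z ^+ As.2 else 0)).
rewrite -(pair_bigA _ (fun A s =>
  \sum_i if locally_even J (A, s, i) then z ^+ s else 0)).
pose f b : R := if b then z else 2 + z.
transitivity (\sum_(A : {set 'I_n}) f (odd #|J :&: A|)).
  apply: eq_bigr => A _; rewrite !big_bool /locally_even /= !addn0 !oddD /=.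
  by rewrite /f expr1 expr0; case: odd => /=; ring.
case: eqVneq => [->|J0].
  under eq_bigr do rewrite set0I cards0 /f.
  exact: sum_set_const.
by apply: (@mulfI _ 2); rewrite ?pnatr_eq0 // sum_parity // /f; ring.
Qed.

End LocalSums.
Arguments local_state : clear implicits.

(** * Local coordinates for consistent pairs *)

Section Encoding.
Context {R : realType} {n m : nat}.

Notation configuration := {ffun 'I_m -> local_state n}.
Implicit Types (J : {set 'I_n}) (c : configuration).

Definition num_matched c : nat := #|[set v | (c v).1.2]|.

Definition even_everywhere J c : bool := [forall v, locally_even J (c v)].

(** Given J the vertices of V are independent, so the generating function of the
    number of matching edges is an m-th power. *)
Lemma generating_function J (z : R) :
  \sum_(c | even_everywhere J c) z ^+ num_matched c
    = (2 ^+ n * (if J == set0 then 2 + z else 1 + z)) ^+ m.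
Proof.
rewrite -sum_locally_even big_mkcond [in RHS]big_mkcond /=.
rewrite -[m in RHS]card_ord -prodr_const bigA_distr_bigA /=.
apply: eq_bigr => c _; rewrite /even_everywhere; case: forallP => [cP|/forallP].
  under eq_bigr => v _ do rewrite cP.
  rewrite prodrXr /num_matched -sum1_card big_mkcond /=; congr (_ ^+ _).
  by apply: eq_bigr => v _; rewrite inE; case: ((c v).1.2).
by rewrite negb_forall => /existsP[v /negbTE cv]; rewrite (bigD1 v) //= cv mul0r.
Qed.

Definition side_of J c : {set 'I_n + 'I_m} :=
  [set u | match u with inl a => a \in J | inr v => (c v).2 end].

Definition edges_of c : {set ('I_n + 'I_m) * 'I_m} :=
  [set e | match e.1 with
           | inl a => a \in (c e.2).1.1
           | inr u => (u == e.2) && (c e.2).1.2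
           end].

Lemma edges_of_Gn c : edges_of c \in powerset (Gn_edges n m).
Proof.
rewrite inE; apply/subsetP => -[[a|u] v]; rewrite !inE //=.
by case/andP.
Qed.

Lemma induced_degree_of J c v :
  induced_degree (side_of J c) (edges_of c) v
    = (#|J :&: (c v).1.1| + ((c v).1.2 && (c v).2))%N.
Proof.
rewrite /induced_degree.
pose I := [set e | match e.1 with inl _ => true | inr _ => false end]
  : {set ('I_n + 'I_m) * 'I_m}.
rewrite -(cardsID I); congr (_ + _)%N.
  have inl_inj : injective (fun a : 'I_n => (inl a : 'I_n + 'I_m, v)).
    by move=> a b [].
  rewrite -(card_imset _ inl_inj).
  apply: eq_card => -[[a|u] w]; rewrite !inE /=; last first.
    by rewrite andbF; apply/esym/imsetP => -[].
  rewrite andbT; apply/and3P/imsetP => [[aw aJ /eqP <-]|[b]].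
    by exists a; rewrite // !inE aJ.
  by rewrite !inE => /andP[bJ bv] [-> ->].
transitivity #|if (c v).1.2 && (c v).2 then [set (inr v, v)]
               else set0 : {set ('I_n + 'I_m) * 'I_m}|; last first.
  by case: ifP; rewrite ?cards1 ?cards0.
apply: eq_card => -[[a|u] w]; rewrite !inE /=.
  by case: ifP; rewrite inE.
case: (eqVneq w v) => [->|wv]; last first.
  by rewrite !andbF; case: ifP; rewrite inE // xpair_eqE (negbTE wv) andbF.
rewrite andbT; case: (eqVneq u v) => [->|uv] /=.
  by case: ifP; rewrite inE ?eqxx.
by case: ifP; rewrite inE // xpair_eqE (inj_eq inr_inj) (negbTE uv).
Qed.

Lemma consistent_of J c :
  consistent (side_of J c) (edges_of c) = even_everywhere J c.
Proof. by apply: eq_forallb => v; rewrite induced_degree_of. Qed.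

Definition num_matching_edges (A : {set ('I_n + 'I_m) * 'I_m}) : nat :=
  #|[set e in A | match e.1 with inl _ => false | inr _ => true end]|.

Lemma num_matching_edges_of c : num_matching_edges (edges_of c) = num_matched c.
Proof.
rewrite /num_matching_edges /num_matched.
have diag_inj : injective (fun v : 'I_m => (inr v : 'I_n + 'I_m, v)).
  by move=> a b [].
rewrite -(card_imset _ diag_inj).
apply: eq_card => -[[a|u] v]; rewrite !inE /=.
  by rewrite andbF; apply/esym/imsetP => -[].
rewrite andbT; apply/andP/imsetP => [[/eqP -> cv]|[w]].
  by exists v; rewrite // inE.
by rewrite inE => cw [-> ->].
Qed.

(** The statistic that separates the phases is 1-Lipschitz, so a cautious chain
    moves it slowly. *)
Lemma num_matching_edges_symdiff (A B : {set ('I_n + 'I_m) * 'I_m}) :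
  (num_matching_edges B <= num_matching_edges A + #|edge_symdiff A B|)%N.
Proof.
apply: leq_trans (leq_card_setU _ _); apply: subset_leq_card.
apply/subsetP => e; rewrite !inE => /andP[eB ->].
by rewrite eB andbT /=; case: (e \in A).
Qed.

Definition encode (x : {set 'I_n} * configuration) :
    {set 'I_n + 'I_m} * Omega (Gn_edges n m) :=
  (side_of x.1 x.2, exist _ (edges_of x.2) (edges_of_Gn x.2)).

Definition decode (y : {set 'I_n + 'I_m} * Omega (Gn_edges n m)) :
    {set 'I_n} * configuration :=
  ([set a | inl a \in y.1],
   [ffun v => ([set a | (inl a, v) \in val y.2], (inr v, v) \in val y.2,
               inr v \in y.1)]).

Lemma encodeK : cancel encode decode.
Proof.
case=> J c; congr (_, _); first by apply/setP => a; rewrite !inE.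
apply/ffunP => v; rewrite ffunE /= /edges_of /side_of !inE /= eqxx /=.
case cv: (c v) => [[A s] i] /=; congr (_, _, _).
by apply/setP => a; rewrite !inE /= cv.
Qed.

Lemma decodeK : cancel decode encode.
Proof.
case=> I A; congr (_, _).
  by apply/setP => -[a|v]; rewrite !inE ?ffunE.
apply: val_inj; apply/setP => -[[a|u] v]; rewrite !inE /= ffunE /= ?inE //.
case: eqVneq => [->//|uv]; apply/esym/negbTE/negP => uvA.
have /subsetP/(_ _ uvA) : val A \subset Gn_edges n m.
  by have := valP A; rewrite inE.
by rewrite inE /= (negbTE uv).
Qed.

Definition phase_weight (Q : pred nat) J : R :=
  \sum_(c | even_everywhere J c) (Q (num_matched c))%:R.

(** Events that depend only on the number of matching edges are computed in the
    local coordinates, through the bijection [encode] from the local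
    descriptions to the pairs (I, A). *)
Lemma sum_pi_Omega (Q : pred nat) :
  \sum_(A : Omega (Gn_edges n m) | Q (num_matching_edges (val A)))
      pi_Omega R (Gn_edges n m) A
  = (\sum_J phase_weight Q J) / (\sum_J phase_weight xpredT J).
Proof.
have enc F : \sum_(I : {set 'I_n + 'I_m}) \sum_(A : Omega (Gn_edges n m)) F I A
    = \sum_J \sum_c F (side_of J c) (exist _ (edges_of c) (edges_of_Gn c)) :> R.
  rewrite !pair_bigA (reindex encode) //.
  by apply: onW_bij; exists decode; [apply: encodeK | apply: decodeK].
have wE (X : pred nat) :
    \sum_(I : {set 'I_n + 'I_m}) \sum_(A : Omega (Gn_edges n m))
      (consistent I (val A) && X (num_matching_edges (val A)))%:R
    = \sum_J phase_weight X J :> R.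
  rewrite enc; apply: eq_bigr => J _; rewrite /phase_weight [RHS]big_mkcond /=.
  apply: eq_bigr => c _; rewrite consistent_of num_matching_edges_of.
  by case: even_everywhere.
rewrite /pi_Omega -mulr_suml -!wE; congr (_ / _); last first.
  rewrite -sum1_card natr_sum big_mkcond /=.
  rewrite (pair_bigA _ (fun I (A : Omega (Gn_edges n m)) =>
    (consistent I (val A) && true)%:R)).
  by apply: eq_bigr => -[I A] _; rewrite inE /= andbT; case: consistent.
rewrite exchange_big /= big_mkcond; apply: eq_bigr => A _.
case: (Q _); last by rewrite big1 // => I _; rewrite andbF.
rewrite -sum1_card natr_sum big_mkcond /=.
by apply: eq_bigr => I _; rewrite inE andbT; case: consistent.
Qed.

End Encoding.

(** * Masses of the two phases and of the window *)

Section Phases.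
Context {R : realType}.

Lemma expR_le_inv (x : R) : 0 <= x < 1 -> expR x <= (1 - x)^-1.
Proof.
move=> /andP[x0 x1]; rewrite -[expR x]invrK -expRN.
rewrite lef_pV2 ?posrE ?expR_gt0 ?subr_gt0 //.
exact: expR_ge1Dx.
Qed.

(** The m-th root of the Chernoff bound for P(k > 3m/8), with k binomial
    (m, 1/3) and tilt 6/5: the moment factor is 2/3 + 1/3 * 6/5 = 16/15. The
    eighth power makes it a comparison of rationals, up to exp (1/72). The value
    6/5 = ((3/8) / (5/8)) / (1/2) is the optimal tilt. *)
Lemma low_phase_rate :
  16 / 15 <= expR (3 / 8 * ln (6 / 5) - 1 / 576) :> R.
Proof.
rewrite -(@ler_pXn2r _ 8) ?nnegrE ?expR_ge0 //.
have -> : expR (3 / 8 * ln (6 / 5) - 1 / 576) ^+ 8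
    = (6 / 5) ^+ 3 * (expR (1 / 72))^-1 :> R.
  rewrite -expRM_natl -expRN -[X in X ^+ 3](@lnK _ (6 / 5)) ?posrE; last by lra.
  by rewrite -expRM_natl -expRD; congr expR; field.
rewrite ler_pdivlMr ?expR_gt0 //.
apply: le_trans (_ : _ <= (16 / 15) ^+ 8 * (1 - 1 / 72)^-1) _; last first.
  have -> : (1 - 1 / 72)^-1 = 72 / 71 :> R by field.
  by lra.
by rewrite ler_wpM2l ?exprn_ge0 //; apply: expR_le_inv; lra.
Qed.

(** Likewise for P(k <= 11m/24), with k binomial (m, 1/2) and tilt 5/6: the
    moment factor is 1/2 + 1/2 * 5/6 = 11/12. The optimal tilt is 11/13; the
    nearby 5/6 is enough and is the inverse of the tilt of the low phase. *)
Lemma high_phase_rate :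
  11 / 12 <= expR (- (11 / 24) * ln (6 / 5) - 1 / 576) :> R.
Proof.
rewrite -(@ler_pXn2r _ 24) ?nnegrE ?expR_ge0 //.
have -> : expR (- (11 / 24) * ln (6 / 5) - 1 / 576) ^+ 24
    = (5 / 6) ^+ 11 * (expR (1 / 24))^-1 :> R.
  have -> : 5 / 6 = (6 / 5)^-1 :> R by lra.
  rewrite -expRM_natl -expRN exprVn -[X in X ^+ 11](@lnK _ (6 / 5)) ?posrE; last by lra.
  by rewrite -expRM_natl -expRN -expRD; congr expR; field.
rewrite ler_pdivlMr ?expR_gt0 //.
apply: le_trans (_ : _ <= (11 / 12) ^+ 24 * (1 - 1 / 24)^-1) _; last first.
  have -> : (1 - 1 / 24)^-1 = 24 / 23 :> R by field.
  by lra.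
by rewrite ler_wpM2l ?exprn_ge0 //; apply: expR_le_inv; lra.
Qed.

Context {n m : nat}.
Implicit Types (J : {set 'I_n}) (Q : pred nat).

Local Notation weight := (@phase_weight R n m).
Local Notation D := (2 ^+ n : R).

Lemma phase_weight_ge0 Q J : 0 <= weight Q J.
Proof. by apply: sumr_ge0 => c _; apply: ler0n. Qed.

Lemma phase_weight_le Q Q' J :
  (forall k, Q k -> Q' k) -> weight Q J <= weight Q' J.
Proof.
move=> QQ'; apply: ler_sum => c _; rewrite ler_nat.
by case: (boolP (Q _)) => // /QQ' ->.
Qed.

Lemma phase_weightC Q J : weight Q J = weight xpredT J - weight (predC Q) J.
Proof.
rewrite -sumrB; apply: eq_bigr => c _ /=.
by case: (Q _); rewrite ?subr0 ?subrr.
Qed.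

Lemma phase_weightT J :
  weight xpredT J = (D * (if J == set0 then 3 else 2)) ^+ m.
Proof.
rewrite /phase_weight; under eq_bigr => c _ do rewrite -(expr1n _ (num_matched c)).
by rewrite generating_function; congr ((_ * _) ^+ _); case: ifP => _; lra.
Qed.

(** Markov's inequality applied to exp (l * (k - th * m)), which is at least 1
    on Q. *)
Lemma phase_weight_chernoff Q J (l th : R) :
    (forall k, Q k -> 0 <= l * (k%:R - th * m%:R)) ->
  weight Q J
    <= (expR (- (l * th))
          * (D * (if J == set0 then 2 + expR l else 1 + expR l))) ^+ m.
Proof.
move=> Ql; rewrite exprMn -generating_function mulr_sumr.
apply: ler_sum => c _; rewrite -!expRM_natl -expRD.
case: (boolP (Q _)) => [/Ql ll|_]; last exact: expR_ge0.
rewrite -[leLHS]expR0 ler_expR; apply: (le_trans ll).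
by lra.
Qed.

Local Notation tail := (expR (- (m%:R / 576)) : R).

Lemma low_phase_tail :
  weight (fun k => (3 * m < 8 * k)%N) set0 <= tail * weight xpredT set0.
Proof.
have ln0 : 0 < ln (6 / 5) :> R by apply: ln_gt0; lra.
apply: le_trans (phase_weight_chernoff (l := ln (6 / 5)) (th := 3 / 8) _ _) _.
  move=> k kQ; rewrite mulr_ge0 ?(ltW ln0) //.
  suff : (3 * m)%:R <= (8 * k)%:R :> R by rewrite !natrM; lra.
  by rewrite ler_nat ltnW.
rewrite phase_weightT eqxx lnK ?posrE; last by lra.
rewrite -[- (m%:R / 576)]mulrN expRM_natl -exprMn.
rewrite lerXn2r ?nnegrE ?mulr_ge0 ?expR_ge0 ?exprn_ge0 //.
have := low_phase_rate; rewrite expRD.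
set a := expR (_ * _); set b := expR _ => ab.
have -> : expR (- (ln (6 / 5) * (3 / 8))) = a^-1 :> R by rewrite expRN /a mulrC.
have -> : expR (- (576)^-1) = b by rewrite /b; congr expR; lra.
rewrite ler_pdivrMl ?expR_gt0 //.
have D0 : 0 <= D by rewrite exprn_ge0.
have := ler_wpM2l D0 ab; lra.
Qed.

Lemma high_phase_tail J : J != set0 ->
  weight (fun k => (24 * k <= 11 * m)%N) J <= tail * weight xpredT J.
Proof.
move=> J0.
have ln0 : 0 < ln (6 / 5) :> R by apply: ln_gt0; lra.
apply: le_trans (phase_weight_chernoff (l := - ln (6 / 5)) (th := 11 / 24) _ _) _.
  move=> k kQ; rewrite mulNr -mulrN mulr_ge0 ?(ltW ln0) //.
  suff : (24 * k)%:R <= (11 * m)%:R :> R by rewrite !natrM; lra.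
  by rewrite ler_nat.
rewrite phase_weightT (negbTE J0) [expR (- ln _)]expRN lnK ?posrE; last by lra.
rewrite -[- (m%:R / 576)]mulrN expRM_natl -exprMn.
rewrite lerXn2r ?nnegrE ?mulr_ge0 ?expR_ge0 ?exprn_ge0 //.
have := high_phase_rate; rewrite expRD.
set a := expR (_ * _); set b := expR _ => ab.
have -> : expR (- (- ln (6 / 5) * (11 / 24))) = a^-1 :> R.
  by rewrite -expRN /a; congr expR; ring.
have -> : expR (- (576)^-1) = b by rewrite /b; congr expR; lra.
rewrite ler_pdivrMl ?expR_gt0 //.
have D0 : 0 <= D by rewrite exprn_ge0.
have -> : 1 + (6 / 5)^-1 = 2 * (11 / 12) :> R by field.
have := ler_wpM2l D0 ab; lra.
Qed.

Lemma sum_phase_weightT_high :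
  \sum_(J | J != set0) weight xpredT J = (D - 1) * (D * 2) ^+ m.
Proof.
rewrite (eq_bigr (fun=> (D * 2) ^+ m)); last first.
  by move=> J /negbTE J0; rewrite phase_weightT J0.
rewrite mulrBl mul1r -[X in _ = X - _]sum_set_const [X in _ = X - _](bigD1 set0) //=.
by rewrite [X in _ = X - _]addrC addrK.
Qed.

(** From 2 <= n on, (3/2) ^ n <= 2 ^ n - 1; for n = 1 this fails. *)
Lemma admissible_ge : admissible R n m -> (2 <= n)%N -> (n <= m)%N.
Proof.
move=> [_ _ /andP[_ Dm]] n2; rewrite leqNgt; apply/negP => mn.
have : (3 / 2) ^+ n <= D - 1.
  rewrite -(subnK n2); elim: (n - 2)%N => [|k IHk]; first by rewrite add0n; lra.
  have h : 1 <= 2 ^+ (k + 2) :> R by apply: exprn_ege1; lra.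
  by rewrite addSn !exprS; lra.
apply/negP; rewrite -ltNge; apply: lt_le_trans Dm _.
by apply: ler_weXn2l => //; lra.
Qed.

Section Balance.
Context (adm : admissible R n m).

Local Notation low := (weight xpredT set0).
Local Notation high := (\sum_(J | J != set0) weight xpredT J).

(** Dividing the weights by (2 * 2 ^ n) ^ m turns them into (3/2) ^ m and
    2 ^ n - 1. *)
Lemma phases_balanced : [/\ 0 < low, low <= high & high <= 3 / 2 * low].
Proof.
have [_ _ /andP[l u]] := adm.
have D0 : 0 < D by rewrite exprn_gt0.
have x0 : 0 < (D * 2) ^+ m :> R by rewrite exprn_gt0 // mulr_gt0.
have -> : low = (D * 2) ^+ m * (3 / 2) ^+ m.
  by rewrite phase_weightT eqxx -exprMn; congr (_ ^+ _); lra.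
rewrite sum_phase_weightT_high; split.
- by rewrite mulr_gt0 // exprn_gt0 //; lra.
- by rewrite mulrC ler_pM2r.
- by rewrite mulrCA [leRHS]mulrC ler_pM2r // -exprS ltW.
Qed.

Local Notation E := (Gn_edges n m).
Local Notation mass Q :=
  (\sum_(A : Omega E | Q (num_matching_edges (val A))) pi_Omega R E A).

Lemma massE Q : mass Q =
  (weight Q set0 + \sum_(J | J != set0) weight Q J) / (low + high).
Proof.
by rewrite sum_pi_Omega [X in X / _](bigD1 set0) // [X in _ / X](bigD1 set0).
Qed.

Lemma subr_tail_ge0 : 0 <= 1 - tail.
Proof.
have m0 : 0 <= m%:R :> R by exact: ler0n.
by rewrite subr_ge0 -[leRHS]expR0 ler_expR; lra.
Qed.

(** The low phase alone provides this mass: it makes up at least 2/5 of the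
    total and is concentrated on k <= 3m/8. *)
Lemma mass_low_ge :
  2 / 5 * (1 - tail) <= mass (fun k => (8 * k <= 3 * m)%N).
Proof.
have [l0 lh hl] := phases_balanced.
rewrite (massE (fun k => (8 * k <= 3 * m)%N)) ler_pdivlMr; last by lra.
have := low_phase_tail.
rewrite (phase_weightC (fun k => (8 * k <= 3 * m)%N) set0).
have -> : weight (predC (fun k => (8 * k <= 3 * m)%N)) set0
    = weight (fun k => (3 * m < 8 * k)%N) set0.
  by apply: eq_bigr => c _; rewrite /= -ltnNge.
have : 0 <= \sum_(J | J != set0) weight (fun k => (8 * k <= 3 * m)%N) J.
  by apply: sumr_ge0 => J _; apply: phase_weight_ge0.
have : (1 - tail) * high <= (1 - tail) * (3 / 2 * low).
  by apply: (ler_wpM2l subr_tail_ge0).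
lra.
Qed.

(** The high phase alone provides this mass, as at most a fraction exp (-m/576)
    of it lies below 11m/24, hence below 3m/8. *)
Lemma mass_high_ge :
  1 / 2 * (1 - tail) <= mass (fun k => (3 * m < 8 * k)%N).
Proof.
have [l0 lh hl] := phases_balanced.
rewrite (massE (fun k => (3 * m < 8 * k)%N)) ler_pdivlMr; last by lra.
have : (1 - tail) * high
    <= \sum_(J | J != set0) weight (fun k => (3 * m < 8 * k)%N) J.
  rewrite mulr_sumr; apply: ler_sum => J J0.
  rewrite (phase_weightC (fun k => (3 * m < 8 * k)%N)).
  rewrite mulrBl mul1r lerB //; apply: le_trans (high_phase_tail J0).
  by apply: phase_weight_le => k /=; lia.
have := phase_weight_ge0 (fun k => (3 * m < 8 * k)%N) set0.
have : (1 - tail) * low <= (1 - tail) * high.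
  by apply: (ler_wpM2l subr_tail_ge0).
lra.
Qed.

(** The window is in the upper tail of the low phase and in the lower tail of
    the high phase. *)
Lemma mass_boundary_le :
  mass (fun k => (3 * m < 8 * k) && (24 * k <= 11 * m))%N <= tail.
Proof.
have [l0 lh hl] := phases_balanced.
rewrite (massE (fun k => (3 * m < 8 * k) && (24 * k <= 11 * m))%N) ler_pdivrMr; last by lra.
rewrite mulrDr; apply: lerD.
  by apply: le_trans low_phase_tail; apply: phase_weight_le => k /andP[].
rewrite mulr_sumr; apply: ler_sum => J J0; apply: le_trans (high_phase_tail J0).
by apply: phase_weight_le => k /andP[].
Qed.

(** What matters is that 1/e is below 1/2, a lower bound for the mass of the
    high phase; (3/2)^2 <= e suffices for this. *)
Lemma expRN1_le : expR (- 1) <= 4 / 9 :> R.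
Proof.
rewrite expRN -[4 / 9]invrK lef_pV2 ?posrE ?invr_gt0 ?expR_gt0 //.
have -> : 1 = 2%:R * (1 / 2) :> R by lra.
rewrite expRM_natl; apply: le_trans (_ : (3 / 2) ^+ 2 <= _); first by lra.
rewrite lerXn2r ?nnegrE ?expR_ge0 //.
by apply: le_trans (expR_ge1Dx _); lra.
Qed.

(** The bound on m makes exp (-m/576) at most 1/36, so that W has mass at least
    1/5 and its complement has mass at least 4/9 + 1/24, where 4/9 exceeds 1/e;
    then 1/120 = 1/5 * 1/24. *)
Lemma Gn_mixing_time_ge d (P : Omega E -> Omega E -> R) :
    (35 * 576 <= m)%N -> (12 * d <= m)%N ->
    transition_matrix P -> stationary_dist P (pi_Omega R E) -> cautious d P ->
  ((1 / 120 * expR (m%:R / 576))%:E <= mixing_time P (pi_Omega R E))%E.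
Proof.
move=> m_large dm tmP piP cP.
pose k (A : Omega E) := num_matching_edges (val A).
pose W := [set A | (8 * k A <= 3 * m)%N].
pose bd := [set A | (3 * m < 8 * k A)%N && (24 * k A <= 11 * m)%N].
have Wbd A B : A \in W -> B \notin W -> 0 < P A B -> B \in bd.
  rewrite !inE -ltnNge => AW -> /cP AB /=.
  have := num_matching_edges_symdiff (val A) (val B); rewrite -/(k A) -/(k B); lia.
have bdE : \sum_(A in bd) pi_Omega R E A <= tail.
  by under eq_bigl => A do rewrite inE; apply: mass_boundary_le.
apply: le_trans (mixing_time_bottleneck tmP piP Wbd (expR_gt0 _) bdE).
have WE : 2 / 5 * (1 - tail) <= \sum_(A in W) pi_Omega R E A.
  by under eq_bigl => A do rewrite inE; apply: mass_low_ge.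
have WcE : 1 / 2 * (1 - tail) <= \sum_(A in ~: W) pi_Omega R E A.
  by under eq_bigl => A do rewrite !inE -ltnNge; apply: mass_high_ge.
have small : tail <= 1 / 36.
  rewrite expRN -[1 / 36]invrK lef_pV2 ?posrE ?invr_gt0 ?expR_gt0 //.
  apply: le_trans (expR_ge1Dx _).
  have : (35 * 576)%:R <= m%:R :> R by rewrite ler_nat.
  rewrite natrM; lra.
rewrite lee_fin [expR (- (_ / _))]expRN invrK ler_wpM2r ?expR_ge0 //.
apply: le_trans (_ : 1 / 5 * (1 / 24) <= _); first by lra.
have e1 := expRN1_le.
by apply: ler_pM; lra.
Qed.

End Balance.
End Phases.

Theorem theorem2 (R : realType) :
  (exists (c : R) (n0 : nat), 0 < c /\
    forall n m : nat, admissible R n m -> (n0 <= n)%N ->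
    forall d : nat, (d%:R : R) <= m%:R / 12 ->
    forall P : Omega (Gn_edges n m) -> Omega (Gn_edges n m) -> R,
      ergodic_chain P ->
      stationary_dist P (pi_Omega R (Gn_edges n m)) ->
      cautious d P ->
      ((c * expR (m%:R / 576))%:E
         <= mixing_time P (pi_Omega R (Gn_edges n m)))%E)
  /\
  (exists (c' : R) (n1 : nat), 0 < c' /\
    forall n m : nat, admissible R n m -> (n1 <= n)%N ->
    forall P : Omega (Gn_edges n m) -> Omega (Gn_edges n m) -> R,
      ergodic_chain P ->
      stationary_dist P (pi_Omega R (Gn_edges n m)) ->
      cautious 1 P ->
      ((expR (c' * (n + 2 * m)%:R))%:E
         <= mixing_time P (pi_Omega R (Gn_edges n m)))%E).
Proof.
split.
  exists (1 / 120), (35 * 576)%N; split=> [|n m adm n0 d dm P [tmP _ _] piP cP].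
    by lra.
  have nm : (n <= m)%N by apply: admissible_ge adm (leq_trans _ n0).
  have d12 : (12 * d <= m)%N by rewrite -(ler_nat R) natrM; lra.
  by apply: (Gn_mixing_time_ge adm _ d12 tmP piP cP); apply: leq_trans nm.
(* As n + 2m <= 3m, the exponent is at most 3m/3456 = m/1152, half of m/576.
   The other half absorbs the factor 1/120: exp (m/1152) >= 1 + 119. *)
exists (1 / 3456), (119 * 1152)%N; split=> [|n m adm n1 P [tmP _ _] piP cP].
  by lra.
have nm : (n <= m)%N by apply: admissible_ge adm (leq_trans _ n1).
have m1 : (119 * 1152 <= m)%N by apply: leq_trans nm.
have m0 : (35 * 576 <= m)%N by apply: leq_trans m1.
have dm : (12 * 1 <= m)%N by apply: leq_trans m1.
apply: le_trans (Gn_mixing_time_ge adm m0 dm tmP piP cP).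
rewrite lee_fin; apply: (@le_trans _ _ (expR (m%:R / 1152))).
  rewrite ler_expR.
  have : (n + 2 * m)%:R <= (3 * m)%:R :> R by rewrite ler_nat; lia.
  rewrite natrM; lra.
have -> : m%:R / 576 = m%:R / 1152 + m%:R / 1152 :> R by lra.
rewrite expRD mulrA ler_peMl ?expR_ge0 //.
have : (119 * 1152)%:R <= m%:R :> R by rewrite ler_nat.
have := expR_ge1Dx (m%:R / 1152 : R).
rewrite natrM; lra.
Qed.
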